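(* Suppose that the sequence $\{\boldsymbol{\alpha}^j\}$ generated by PASSCoDe-Wild converges to $\hat{\boldsymbol{\alpha}}\in\mathbb{R}^n$ and that the sequence $\{\hat{\boldsymbol{w}}^j\}$ of primal vectors maintained in shared memory converges to $\hat{\boldsymbol{w}}\in\mathbb{R}^d$. Put $\bar{\boldsymbol{w}}=\sum_{i=1}^n\hat\alpha_i\boldsymbol{x}_i$ and $\boldsymbol{\epsilon}=\bar{\boldsymbol{w}}-\hat{\boldsymbol{w}}\in\mathbb{R}^d$. Then $\hat{\boldsymbol{\alpha}}$ is an optimal solution of the perturbed dual problem $$\hat{\boldsymbol{\alpha}}=\arg\min_{\boldsymbol{\alpha}\in\mathbb{R}^n}\ D(\boldsymbol{\alpha})-\sum_{i=1}^n\alpha_i\,\boldsymbol{\epsilon}^T\boldsymbol{x}_i,$$ and $\bar{\boldsymbol{w}}$ is the solution of the corresponding primal problem $$\bar{\boldsymbol{w}}=\arg\min_{\boldsymbol{w}\in\mathbb{R}^d}\ \tfrac12\boldsymbol{w}^T\boldsymbol{w}+\sum_{i=1}^n\ell_i\big((\boldsymbol{w}-\boldsymbol{\epsilon})^T\boldsymbol{x}_i\big).$$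
   Context: Let $\boldsymbol{x}_1,\dots,\boldsymbol{x}_n\in\mathbb{R}^d$ be nonzero and let $\ell_i:\mathbb{R}\to\mathbb{R}$ be convex loss functions with conjugates $\ell_i^*(u)=\sup_z(zu-\ell_i(z))$. The dual objective is $$D(\boldsymbol{\alpha})=\tfrac12\Big\|\sum_{i=1}^n\alpha_i\boldsymbol{x}_i\Big\|^2+\sum_{i=1}^n\ell_i^*(-\alpha_i),\qquad\boldsymbol{\alpha}\in\mathbb{R}^n .$$ PASSCoDe-Wild (model). At each step $j=0,1,2,\dots$ an index $i(j)\in\{1,\dots,n\}$ is selected and $$\Delta\alpha_j=\arg\min_\delta\ \tfrac12\|\hat{\boldsymbol{w}}^j+\delta\boldsymbol{x}_{i(j)}\|^2+\ell^*_{i(j)}\big(-(\alpha^j_{i(j)}+\delta)\big),\qquad \alpha^{j+1}_{i(j)}=\alpha^j_{i(j)}+\Delta\alpha_j,\qquad \alpha^{j+1}_t=\alpha^j_t\ (t\neq i(j)),$$ where $\hat{\boldsymbol{w}}^j\in\mathbb{R}^d$ is the vector currently in shared memory. Since the writes $\boldsymbol{w}\leftarrow\boldsymbol{w}+\Delta\alpha_j\boldsymbol{x}_{i(j)}$ are done without locks or atomic operations, some may be lost, so no relation between $\hat{\boldsymbol{w}}^j$ and $\sum_i\alpha_i^j\boldsymbol{x}_i$ is assumed. Indices are sampled at random so that every $i\in\{1,\dots,n\}$ is selected infinitely often (this holds almost surely under uniform random sampling). *)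

(* Defs.v *)
From mathcomp Require Export all_boot all_order all_algebra.
From mathcomp Require Export all_classical all_reals all_analysis.

Set Implicit Arguments.
Unset Strict Implicit.
Unset Printing Implicit Defensive.
Export Order.TTheory GRing.Theory Num.Theory.
Export numFieldNormedType.Exports.

Local Open Scope classical_set_scope.
Local Open Scope ring_scope.

Definition argmin (disp : Order.disp_t) (S : porderType disp) (T : Type)
    (f : T -> S) : set T :=
  [set x | forall y, (f x <= f y)%O].

(* The canonical norm on matrices is the sup norm, so the Euclidean structure is
   introduced separately; the topologies agree. *)
Definition dotp (R : realType) (d : nat) (u v : 'cV[R]_d) : R :=
  (u^T *m v) 0 0.

Definition sqnorm (R : realType) (d : nat) (u : 'cV[R]_d) : R := dotp u u.

(* Extended-valued: for a finite l it is never -oo, so the sums below never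
   meet an indeterminate form. *)
Definition conjugate (R : realType) (l : R -> R) (u : R) : \bar R :=
  ereal_sup [set (z * u - l z)%:E | z in [set: R]].

Definition lincomb (R : realType) (d n : nat) (x : 'I_n -> 'cV[R]_d)
    (alpha : 'cV[R]_n) : 'cV[R]_d :=
  \sum_(t < n) alpha t 0 *: x t.

Definition dual_objective (R : realType) (d n : nat) (x : 'I_n -> 'cV[R]_d)
    (l : 'I_n -> R -> R) (alpha : 'cV[R]_n) : \bar R :=
  ((2^-1 * sqnorm (lincomb x alpha))%:E
   + \sum_(t < n) conjugate (l t) (- alpha t 0)%R)%E.

Definition perturbed_dual (R : realType) (d n : nat) (x : 'I_n -> 'cV[R]_d)
    (l : 'I_n -> R -> R) (eps : 'cV[R]_d) (alpha : 'cV[R]_n) : \bar R :=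
  (dual_objective x l alpha - (\sum_(t < n) alpha t 0 * dotp eps (x t))%:E)%E.

Definition perturbed_primal (R : realType) (d n : nat) (x : 'I_n -> 'cV[R]_d)
    (l : 'I_n -> R -> R) (eps w : 'cV[R]_d) : R :=
  2^-1 * dotp w w + \sum_(t < n) l t (dotp (w - eps) (x t)).

Definition coordinate_objective (R : realType) (d : nat) (xi : 'cV[R]_d)
    (li : R -> R) (w : 'cV[R]_d) (ai delta : R) : \bar R :=
  ((2^-1 * sqnorm (w + delta *: xi))%:E + conjugate li (- (ai + delta))%R)%E.

(* idx j, Delta j, alpha j, w_sh j are the index, the increment, the dual iterate
   and the shared-memory vector at step j.  Since writes to shared memory may be
   lost, w_sh is an arbitrary sequence, unrelated to lincomb x (alpha j). *)
Definition passcode_wild (R : realType) (d n : nat) (x : 'I_n -> 'cV[R]_d)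
    (l : 'I_n -> R -> R) (idx : nat -> 'I_n) (Delta : nat -> R)
    (alpha : nat -> 'cV[R]_n) (w_sh : nat -> 'cV[R]_d) : Prop :=
  forall j : nat,
    argmin (coordinate_objective (x (idx j)) (l (idx j)) (w_sh j)
              (alpha j (idx j) 0)) (Delta j) /\
    forall t : 'I_n, alpha j.+1 t 0 =
      if t == idx j then alpha j t 0 + Delta j else alpha j t 0.

(* Main.v *)
(** If coordinate [t] is updated infinitely often, passing to the limit in its
    update shows that [alphahat t] minimizes
    [a |-> (what + (a - alphahat t) x_t)^2 / 2 + l_t^* (- a)]; lower
    semicontinuity of the conjugate is all that is needed, since it is a supremum
    of affine functions.  Dropping the quadratic term, which is of second order,
    [- alphahat t] is a subgradient of [l_t] at [<what, x_t>].  These [n]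
    subgradient inequalities (respectively their Fenchel-Young forms), summed over
    [t], reduce both optimality claims to a completion of the square. *)
Require Import Defs.
From mathcomp Require Import ring lra.

Local Open Scope classical_set_scope.
Local Open Scope ring_scope.

(** * Euclidean inner product on column vectors *)

Section DotProduct.
Context {R : realType} {d : nat}.
Implicit Types (u v w : 'cV[R]_d) (a : R).

Lemma dotpE u v : dotp u v = \sum_i u i 0 * v i 0.
Proof. by rewrite /dotp mxE; apply: eq_bigr => i _; rewrite mxE. Qed.

Lemma dotpC u v : dotp u v = dotp v u.
Proof. by rewrite !dotpE; apply: eq_bigr => i _; rewrite mulrC. Qed.

Lemma dotpDl u v w : dotp (u + v) w = dotp u w + dotp v w.
Proof. by rewrite /dotp linearD mulmxDl mxE. Qed.

Lemma dotpDr u v w : dotp u (v + w) = dotp u v + dotp u w.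
Proof. by rewrite /dotp mulmxDr mxE. Qed.

Lemma dotpZl a u v : dotp (a *: u) v = a * dotp u v.
Proof. by rewrite /dotp linearZ -scalemxAl mxE. Qed.

Lemma dotpZr a u v : dotp u (a *: v) = a * dotp u v.
Proof. by rewrite /dotp -scalemxAr mxE. Qed.

Lemma dotpBl u v w : dotp (u - v) w = dotp u w - dotp v w.
Proof. by rewrite dotpDl -scaleN1r dotpZl mulN1r. Qed.

Lemma dotpBr u v w : dotp u (v - w) = dotp u v - dotp u w.
Proof. by rewrite dotpC dotpBl ![dotp _ u]dotpC. Qed.

Lemma sqnorm_ge0 u : 0 <= sqnorm u.
Proof. by rewrite /sqnorm dotpE sumr_ge0// => i _; rewrite -expr2 sqr_ge0. Qed.

Lemma sqnorm_le0 u : sqnorm u <= 0 -> u = 0.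
Proof.
rewrite /sqnorm dotpE => u0; apply/colP => i; rewrite mxE; apply/eqP.
rewrite -sqrf_eq0 eq_le sqr_ge0 andbT expr2 (le_trans _ u0)//.
by rewrite (bigD1 i)//= lerDl sumr_ge0// => k _; rewrite -expr2 sqr_ge0.
Qed.

Lemma sqnormD u v : sqnorm (u + v) = sqnorm u + 2 * dotp u v + sqnorm v.
Proof. by rewrite /sqnorm dotpDl !dotpDr [dotp v u]dotpC; ring. Qed.

Lemma sqnormB u v : sqnorm (u - v) = sqnorm u - 2 * dotp u v + sqnorm v.
Proof. by rewrite /sqnorm dotpBl !dotpBr [dotp v u]dotpC; ring. Qed.

Lemma dotp_lincomb n u (x : 'I_n -> 'cV[R]_d) (alpha : 'cV[R]_n) :
  dotp u (lincomb x alpha) = \sum_t alpha t 0 * dotp u (x t).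
Proof.
rewrite {1}/dotp /lincomb mulmx_sumr summxE; apply: eq_bigr => t _.
exact: dotpZr.
Qed.

Lemma cvg_dotpl (w_ : nat -> 'cV[R]_d) w v :
  w_ @ \oo --> w -> dotp (w_ j) v @[j --> \oo] --> dotp w v.
Proof.
move=> w_w; under eq_fun do rewrite dotpE.
rewrite dotpE; apply: cvg_big => [|i _]; first exact: add_continuous.
apply: cvgMl; exact: (cvg_comp _ _ w_w (@coord_continuous _ _ _ i 0 w)).
Qed.

End DotProduct.

(** * Subgradients and conjugates of convex functions on the line *)

Section ConvexAnalysis.
Context {R : realType}.
Implicit Types (l : R -> R) (a b c u v z : R).

Lemma convex_functionR l a b (p : R) : @convex_function R R^o [set: R^o] l ->
  0 <= p <= 1 -> l (p * a + (1 - p) * b) <= p * l a + (1 - p) * l b.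
Proof.
move=> cl p01.
have pP : Itv.spec (@Itv.num_sem R) (Itv.Real `[0%Z, 1%Z]) p.
  by apply/andP; split; [exact: num_real | rewrite /= in_itv/= p01].
by have := cl (Itv.mk pP) a b; apply; rewrite inE.
Qed.

Lemma convex_slopes l a c b : @convex_function R R^o [set: R^o] l ->
  a < c -> c < b -> (l c - l a) / (c - a) <= (l b - l c) / (b - c).
Proof.
move=> cl ac cb; have ca0 : 0 < c - a by lra.
have bc0 : 0 < b - c by lra.
have ba0 : 0 < b - a by lra.
have p01 : 0 <= (b - c) / (b - a) <= 1.
  by rewrite divr_ge0 ?ler_pdivrMr ?mul1r//=; lra.
have := @convex_functionR l a b _ cl p01.
have -> : (b - c) / (b - a) * a + (1 - (b - c) / (b - a)) * b = c.
  by field; lra.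
have -> : (b - c) / (b - a) * l a + (1 - (b - c) / (b - a)) * l b =
    ((b - c) * l a + (c - a) * l b) / (b - a) by field; lra.
rewrite ler_pdivlMr// ler_pdivrMr// mulrAC ler_pdivlMr//; nra.
Qed.

(** The supremum of the slopes to the left of [c] is a subgradient: by [convex_slopes] every slope
    to the right bounds it from above. *)
Lemma convex_subgradient l c : @convex_function R R^o [set: R^o] l ->
  exists v, forall z, l c + v * (z - c) <= l z.
Proof.
move=> cl; pose E := [set (l c - l a) / (c - a) | a in [set a | a < c]].
have E0 : E !=set0 by exists ((l c - l (c - 1)) / (c - (c - 1))), (c - 1) => //=; lra.
have Eub b : c < b -> ubound E ((l b - l c) / (b - c)).
  by move=> cb _ [a /= ac <-]; exact: convex_slopes.
exists (sup E) => z; have [zc|cz|->] := ltgtP z c; last by lra.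
- have : (l c - l z) / (c - z) <= sup E.
    apply: sup_upper_bound; last by exists z.
    by split=> //; exists ((l (c + 1) - l c) / (c + 1 - c)); apply: Eub; lra.
  by rewrite ler_pdivrMr ?subr_gt0//; lra.
- have := ge_sup E0 (Eub _ cz).
  by rewrite ler_pdivlMr ?subr_gt0//; lra.
Qed.

Lemma conjugate_leP l u (M : R) :
  (conjugate l u <= M%:E)%E <-> forall z, z * u - l z <= M.
Proof.
split=> [lM z|lM].
  by rewrite -lee_fin (le_trans _ lM)//; apply: ereal_sup_ubound; exists z.
by apply: ge_ereal_sup => _ [z _ <-]; rewrite lee_fin.
Qed.

Lemma fenchel_young l u z : ((z * u - l z)%:E <= conjugate l u)%E.
Proof. by apply: ereal_sup_ubound; exists z. Qed.

Lemma fenchel_young_eq l u c : (forall z, z * u - l z <= c * u - l c) ->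
  conjugate l u = (c * u - l c)%:E.
Proof.
by move=> uc; apply/eqP; rewrite eq_le fenchel_young andbT; apply/conjugate_leP.
Qed.

(* The hypothesis says that [u] minimizes
   [v |-> K (u - v)^2 + c (u - v) + conjugate l v], and the conclusion that [u]
   is a subgradient of [l] at [c].  It is enough to test [u] against points of
   the segment from [u] to one subgradient at [c]. *)
Lemma prox_subgradient l c u (K : R) : @convex_function R R^o [set: R^o] l ->
  (forall v M, (conjugate l v <= M%:E)%E ->
    (conjugate l u <= ((u - v) * c + (u - v) ^+ 2 * K + M)%:E)%E) ->
  forall z, z * u - l z <= c * u - l c.
Proof.
move=> cl umin; have [v0 v0P] := @convex_subgradient l c cl.
have lv0 : (conjugate l v0 <= (c * v0 - l c)%:E)%E.
  by apply/conjugate_leP => z; have := v0P z; lra.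
(* Testing [u] against [v0] excludes [+oo]; Fenchel-Young excludes [-oo]. *)
have [L LE] : exists L, conjugate l u = L%:E.
  have := umin _ _ lv0; have := fenchel_young l u c.
  by case: (conjugate l u) => // L; exists L.
apply/conjugate_leP; rewrite LE lee_fin; apply/ler_addgt0Pr => e e0.
pose E := (v0 - u) ^+ 2 * K.
(* Step length along the segment, small enough that [th * E <= e]; the [+ 1] keeps the denominator
   positive when [E] is 0. *)
pose th := Num.min 1 (e / (`|E| + 1)).
have E1 : 0 < `|E| + 1 by rewrite ltr_wpDl.
have th0 : 0 < th by rewrite lt_min ltr01 divr_gt0.
have th1 : th <= 1 by rewrite ge_min lexx.
have thE : th * E <= e.
  apply: (@le_trans _ _ (th * (`|E| + 1))).
    by rewrite ler_pM2l//; have := ler_norm E; lra.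
  by rewrite -ler_pdivlMr// ge_min lexx orbT.
have /umin : (conjugate l (u + th * (v0 - u)) <=
    ((1 - th) * L + th * (c * v0 - l c))%:E)%E.
  apply/conjugate_leP => z.
  have -> : z * (u + th * (v0 - u)) - l z =
    (1 - th) * (z * u - l z) + th * (z * v0 - l z) by ring.
  rewrite lerD ?ler_wpM2l ?subr_ge0 ?(ltW th0)//.
    by have := fenchel_young l u z; rewrite LE lee_fin.
  by have /conjugate_leP := lv0.
rewrite LE lee_fin => LM.
(* The quadratic cost is [th ^+ 2 * K] times a constant, so after division by [th] it is still at
   most [e]. *)
suff : th * L <= th * (c * u - l c + th * E) by rewrite ler_pM2l//; lra.
by move: LM; rewrite /E; lra.
Qed.

End ConvexAnalysis.

(** A positive limit would make [f] eventually positive. The sign is asked only infinitely often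
    because a given coordinate is updated only at some steps. *)
Lemma cvg_frequently_le0 (R : realType) (f : nat -> R) (a : R) :
  f @ \oo --> a -> (forall N, exists j, (N <= j)%N /\ f j <= 0) -> a <= 0.
Proof.
move=> fa ffreq; rewrite leNgt; apply/negP => a0.
have [N _ fN] := cvgr_gt _ fa _ a0.
have [j [Nj]] := ffreq N; rewrite leNgt => /negP; apply; exact: fN.
Qed.

(** * Limit of the updates and optimality of the perturbed pair *)

Section PasscodeWild.
Context {R : realType} {d n : nat}.
Variables (x : 'I_n -> 'cV[R]_d) (l : 'I_n -> R -> R).

Lemma passcode_wild_limit (idx : nat -> 'I_n) (Delta : nat -> R)
    (alpha : nat -> 'cV[R]_n) (w_sh : nat -> 'cV[R]_d)
    (alphahat : 'cV[R]_n) (what : 'cV[R]_d) (t : 'I_n) :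
  passcode_wild x l idx Delta alpha w_sh ->
  (forall N, exists j, (N <= j)%N /\ idx j = t) ->
  alpha @ \oo --> alphahat -> w_sh @ \oo --> what ->
  forall v M, (conjugate (l t) v <= M%:E)%E ->
  (conjugate (l t) (- alphahat t 0)%R <=
    ((- alphahat t 0 - v) * dotp what (x t)
      + (- alphahat t 0 - v) ^+ 2 * (2^-1 * sqnorm (x t)) + M)%:E)%E.
Proof.
move=> Hwild idx_inf alpha_cvg w_cvg v M lvM.
(* Lower semicontinuity in action: for fixed [z] the conjugate on the left becomes an affine
   function, and the limit is one of real sequences. *)
apply/conjugate_leP => z; rewrite -subr_le0.
set K := 2^-1 * sqnorm (x t).
have a_cvg : alpha j t 0 @[j --> \oo] --> alphahat t 0.
  exact: (cvg_comp _ _ alpha_cvg (@coord_continuous _ _ _ t 0 alphahat)).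
have a1_cvg : alpha j.+1 t 0 @[j --> \oo] --> alphahat t 0.
  by rewrite -(cvg_shiftS (fun j => alpha j t 0)) in a_cvg.
have b_cvg := @cvg_dotpl _ _ _ _ (x t) w_cvg.
(* [p j] equals [Delta j] when [idx j = t], and tends to 0 along all [j]; [q j] is the competing
   increment that moves the dual argument to [v]. *)
pose p j := alpha j.+1 t 0 - alpha j t 0.
pose q j := - alpha j t 0 - v.
have p_cvg : p j @[j --> \oo] --> (0 : R).
  by rewrite -(subrr (alphahat t 0)); exact: cvgB.
have q_cvg : q j @[j --> \oo] --> - alphahat t 0 - v.
  by apply: cvgB; [exact: cvgN | exact: cvg_cst].
pose f j := p j * dotp (w_sh j) (x t) + p j * p j * K
  + (z * - alpha j.+1 t 0 - l t z)
  - (q j * dotp (w_sh j) (x t) + q j * q j * K + M).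
apply: (@cvg_frequently_le0 _ f).
  have -> : z * - alphahat t 0 - l t z - ((- alphahat t 0 - v) * dotp what (x t)
      + (- alphahat t 0 - v) ^+ 2 * K + M) =
    0 * dotp what (x t) + 0 * 0 * K + (z * - alphahat t 0 - l t z)
    - ((- alphahat t 0 - v) * dotp what (x t)
      + (- alphahat t 0 - v) * (- alphahat t 0 - v) * K + M) by ring.
  apply: cvgB; apply: cvgD; do ?apply: cvgD; do ?exact: cvg_cst;
    do ?[exact: cvgM | by apply: cvgMl; exact: cvgM].
  by apply: cvgMr; exact: cvgN.
move=> N; have [j [Nj jt]] := idx_inf N; exists j; split => //.
have [+ /(_ t)] := Hwild j; rewrite jt eqxx => jmin ajt.
have {jmin} := jmin (q j); rewrite /coordinate_objective.
have -> : - (alpha j t 0 + q j) = v by rewrite /q; ring.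
rewrite -ajt => jmin.
have : ((2^-1 * sqnorm (w_sh j + Delta j *: x t))%:E +
   (z * - alpha j.+1 t 0 - l t z)%:E <=
   (2^-1 * sqnorm (w_sh j + q j *: x t))%:E + M%:E)%E.
  apply: (le_trans (leeD2l _ (fenchel_young _ _ _))).
  by apply: (le_trans jmin); exact: leeD2l.
rewrite -!EFinD lee_fin !sqnormD /sqnorm !dotpZr !dotpZl -!/(sqnorm _).
rewrite /f /K /p ajt; lra.
Qed.

(* Optimality system of the perturbed pair: [- alphahat t] is a subgradient of
   [l t] at [<what, x t>] for every [t]. *)
Variables (alphahat : 'cV[R]_n) (what : 'cV[R]_d).
Hypothesis subg : forall t z, z * - alphahat t 0 - l t z <=
  dotp what (x t) * - alphahat t 0 - l t (dotp what (x t)).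

(** Fenchel-Young is an equality at [alphahat] and an inequality at [beta]. The terms in [what]
    cancel, which leaves half of [sqnorm (lincomb x beta - lincomb x alphahat)] as the gap. *)
Lemma perturbed_dual_argmin :
  argmin (perturbed_dual x l (lincomb x alphahat - what)) alphahat.
Proof.
set c := fun t => dotp what (x t).
have dualE (beta : 'cV[R]_n) : perturbed_dual x l (lincomb x alphahat - what) beta =
   ((2^-1 * sqnorm (lincomb x beta)
     - dotp (lincomb x alphahat - what) (lincomb x beta))%:E
    + \sum_(t < n) conjugate (l t) (- beta t 0)%R)%E.
  by rewrite /perturbed_dual /dual_objective -dotp_lincomb addeAC -EFinN -EFinD.
have lowE (beta : 'cV[R]_n) : \sum_(t < n) (c t * - beta t 0 - l t (c t)) =
    - dotp what (lincomb x beta) - \sum_(t < n) l t (c t).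
  rewrite sumrB dotp_lincomb; congr (_ - _); rewrite -sumrN.
  by apply: eq_bigr => t _; rewrite /c; ring.
move=> beta; rewrite !dualE.
have -> : (\sum_(t < n) conjugate (l t) (- alphahat t 0)%R)%E =
    (\sum_(t < n) (c t * - alphahat t 0 - l t (c t)))%:E.
  by rewrite -sumEFin; apply: eq_bigr => t _; exact: fenchel_young_eq.
have : ((\sum_(t < n) (c t * - beta t 0 - l t (c t)))%:E <=
    \sum_(t < n) conjugate (l t) (- beta t 0)%R)%E.
  by rewrite -sumEFin; apply: lee_sum => t _; exact: fenchel_young.
move=> /(leeD2l _) /(le_trans _); apply; rewrite -!EFinD lee_fin !lowE.
have := sqnorm_ge0 (lincomb x beta - lincomb x alphahat).
rewrite sqnormB !dotpBl [dotp (lincomb x beta) _]dotpC -!/(sqnorm _); lra.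
Qed.

(** The linear terms of the summed subgradient inequalities cancel the cross term of the square. The
    quadratic gap kept here yields uniqueness as well as minimality. *)
Lemma perturbed_primal_growth w :
  perturbed_primal x l (lincomb x alphahat - what) (lincomb x alphahat)
    + 2^-1 * sqnorm (w - lincomb x alphahat)
  <= perturbed_primal x l (lincomb x alphahat - what) w.
Proof.
rewrite /perturbed_primal subKr opprB addrCA.
have : \sum_(t < n) (l t (dotp what (x t))
      - alphahat t 0 * dotp (w - lincomb x alphahat) (x t)) <=
    \sum_(t < n) l t (dotp (what + (w - lincomb x alphahat)) (x t)).
  apply: ler_sum => t _.
  by have := subg t (dotp (what + (w - lincomb x alphahat)) (x t));
    rewrite dotpDl; lra.
rewrite sumrB -dotp_lincomb sqnormB dotpBl -!/(sqnorm _); lra.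
Qed.

Lemma perturbed_primal_argmin :
  argmin (perturbed_primal x l (lincomb x alphahat - what)) =
  [set lincomb x alphahat].
Proof.
apply/seteqP; split=> [w wmin|_ -> w]; last first.
  have := perturbed_primal_growth w.
  by have := sqnorm_ge0 (w - lincomb x alphahat); lra.
apply/eqP; rewrite -subr_eq0; apply/eqP/sqnorm_le0.
by have := perturbed_primal_growth w; have := wmin (lincomb x alphahat); lra.
Qed.

End PasscodeWild.

Theorem theorem3 (R : realType) (d n : nat) (x : 'I_n -> 'cV[R]_d)
    (l : 'I_n -> R -> R)
    (x_neq0 : forall t : 'I_n, x t != 0)
    (l_convex : forall t : 'I_n, @convex_function R R^o [set: R^o] (l t))
    (idx : nat -> 'I_n) (Delta : nat -> R)
    (alpha : nat -> 'cV[R]_n) (w_sh : nat -> 'cV[R]_d)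
    (Hwild : passcode_wild x l idx Delta alpha w_sh)
    (idx_inf : forall (t : 'I_n) (N : nat),
       exists j : nat, (N <= j)%N /\ idx j = t)
    (alphahat : 'cV[R]_n) (what : 'cV[R]_d)
    (alpha_cvg : alpha @ \oo --> alphahat)
    (w_sh_cvg : w_sh @ \oo --> what) :
  let wbar := lincomb x alphahat in
  let eps := wbar - what in
  argmin (perturbed_dual x l eps) alphahat /\
  argmin (perturbed_primal x l eps) = [set wbar].
Proof.
have subg t : forall z, z * - alphahat t 0 - l t z <=
    dotp what (x t) * - alphahat t 0 - l t (dotp what (x t)).
  (* Here [c] is [dotp what (x t)], [u] is [- alphahat t 0] and [K] is [2^-1 * sqnorm (x t)]. *)
  apply: (@prox_subgradient _ (l t) _ _ _ (l_convex t)).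
  exact: passcode_wild_limit Hwild (idx_inf t) alpha_cvg w_sh_cvg.
move=> wbar eps; split; first exact: perturbed_dual_argmin.
exact: perturbed_primal_argmin.
Qed.
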